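(* There exists a set $A \subseteq \mathbb{Z}$ with $r_A(n) = 1$ for every integer $n$ such that, for all $x \geq 1$, \[ \frac{2\log x}{\log 5} + 2\left(1 - \frac{\log 3}{\log 5}\right) \leq A(-x,x) \leq \frac{2\log x}{\log 3} + 2. \]
   Context: For a set $A$ of integers, $r_A(n)$ denotes the number of pairs $(a,a') \in A \times A$ with $a \leq a'$ and $a + a' = n$. $A(-x,x)$ denotes the number of elements $a \in A$ with $-x \leq a \leq x$. *)

(* Defs.v *)
From mathcomp Require Import all_boot all_order all_algebra finmap.
From mathcomp Require Import all_classical all_reals all_analysis.

Set Implicit Arguments.
Unset Strict Implicit.
Unset Printing Implicit Defensive.

Import Order.TTheory GRing.Theory Num.Theory.

Local Open Scope classical_set_scope.
Local Open Scope ring_scope.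

Definition representations (A : set int) (n : int) : set (int * int) :=
  [set p | [/\ A p.1, A p.2, p.1 <= p.2 & p.1 + p.2 = n]].

(* [fset_set] sends an infinite set to the empty finite set, so [rep_count A n]
   is 0 when [n] has infinitely many representations; an equation
   [rep_count A n = k] with [k > 0] asserts exactly [k] representations. *)
Definition rep_count (A : set int) (n : int) : nat :=
  #|` fset_set (representations A n)|%fset.

Definition elements_between (R : realType) (A : set int) (y x : R) : set int :=
  [set a | A a /\ y <= a%:~R <= x].

(* The set counted here is always finite. *)
Definition count_between (R : realType) (A : set int) (y x : R) : nat :=
  #|` fset_set (elements_between A y x)|%fset.

(* Main.v *)
Require Import Defs.
From mathcomp Require Import all_boot all_order all_algebra finmap.
From mathcomp Require Import all_classical all_reals all_analysis.
From mathcomp Require Import zify ring lra.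

Import Order.TTheory GRing.Theory Num.Theory.

Local Open Scope classical_set_scope.
Local Open Scope ring_scope.

(** Nathanson's greedy construction.  Start from {0, 1}; given a finite Sidon set
    [s] with largest absolute value [d], let [b] be the first integer in the order
    0, 1, -1, 2, -2, ... that is not in [s + s], and adjoin [u = -3d] (if
    [b >= 0]) or [u = 3d] (if [b < 0]) together with [b - u].  All sums involving
    a new element are new, so the set remains Sidon, and the union represents every
    integer.  If both [2d - 1] and [1 - 2d] were sums, then [d] and [-d] would be in
    [s], giving 0 = 0 + 0 = d + (-d); hence [|b| <= 2d - 1], and the new radius
    [3d + |b|] lies between [3d] and [5d].  The k-th radius is thus between [3^k] and
    [5^k], and the union has 2k + 2 elements of absolute value at most [x] for
    [d <= x < 3d], and 2k + 3 for [3d <= x < 3d + |b|]. *)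

(** * Enumeration of the integers, sumsets and Sidon sets *)

Definition enum_int (n : nat) : int :=
  if odd n then (uphalf n)%:Z else - (n./2)%:Z.

Lemma enum_int_surj (z : int) : exists n, enum_int n = z.
Proof.
case: (leP z 0) => z0.
- exists (`|z|.*2)%N; rewrite /enum_int odd_double doubleK; lia.
- exists (`|z|.*2.-1)%N.
  have -> : (`|z|.*2.-1 = (`|z|.-1).*2.+1)%N by lia.
  rewrite /enum_int /= odd_double /= doubleK; lia.
Qed.

Lemma enum_int_abs (n : nat) : `|enum_int n|%N = uphalf n.
Proof. by rewrite /enum_int; case: ifP; lia. Qed.

Definition sums (s : seq int) : seq int := [seq a + b | a <- s, b <- s].

Lemma sumsP (s : seq int) (n : int) :
  reflect (exists a b, [/\ a \in s, b \in s & n = a + b]) (n \in sums s).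
Proof.
apply: (iffP allpairsP) => [[[a b] /= [? ? ?]]|[a [b [? ? ?]]]].
- by exists a, b.
- by exists (a, b).
Qed.

(** Equality of the smaller summands suffices: [b = e] follows by cancellation. *)
Definition sidon (s : seq int) : Prop :=
  forall a b c e : int, a \in s -> b \in s -> c \in s -> e \in s ->
    a <= b -> c <= e -> a + b = c + e -> a = c.

(** * The greedy step and its iterates *)

Definition missing_index (s : seq int) (d : nat) : nat :=
  find (fun n => enum_int n \notin sums s) (iota 0 (4 * d)).

Definition missing (s : seq int) (d : nat) : int :=
  enum_int (missing_index s d).

(** The sign opposite to that of [b] puts [b - inner d b] on the other side of zero, at distance
    [3d + |b|]. *)
Definition inner (d : nat) (b : int) : int :=
  if 0 <= b then - (3 * d)%:Z else (3 * d)%:Z.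

Definition step (p : seq int * nat) : seq int * nat :=
  let: (s, d) := p in
  let b := missing s d in
  ([:: b - inner d b, inner d b & s], (3 * d + `|b|)%N).

Definition stage (k : nat) : seq int * nat := iter k step ([:: 1; 0], 1%N).

Definition elems (k : nat) : seq int := (stage k).1.

Definition radius (k : nat) : nat := (stage k).2.

(** * The invariant of the construction and its preservation *)

Definition admissible (s : seq int) (d : nat) : Prop :=
  [/\ 0 \in s, (0 < d)%N, {in s, forall a, (`|a| <= d)%N}, uniq s & sidon s].

Lemma not_both_radii (s : seq int) (d : nat) :
  admissible s d -> d%:Z \in s -> - d%:Z \in s -> False.
Proof.
move=> [s0 d0 _ _ sid] ds nds.
have := sid _ _ _ _ nds ds s0 s0; lia.
Qed.

(** Of [2d - 1] and [1 - 2d], found at indices [4d - 3] and [4d - 2], at least one is not a sum. So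
    the bounded search succeeds and [find] never returns its default. *)
Lemma missing_indexP (s : seq int) (d : nat) : admissible s d ->
  [/\ (missing_index s d < (4 * d).-1)%N, missing s d \notin sums s &
      forall j, (j < missing_index s d)%N -> enum_int j \in sums s].
Proof.
move=> adm; have [s0 d0 sd _ _] := adm.
have [j [jd jP]] : exists j, (j < (4 * d).-1)%N /\ enum_int j \notin sums s.
  case: (boolP (enum_int (4 * d - 3) \in sums s)) => [/sumsP|]; last first.
    by exists (4 * d - 3)%N; split=> //; lia.
  case: (boolP (enum_int (4 * d - 2) \in sums s)) => [/sumsP|]; last first.
    by exists (4 * d - 2)%N; split=> //; lia.
  have -> : enum_int (4 * d - 2) = 1 - (2 * d)%:Z.
    by rewrite /enum_int; case: ifP; lia.
  have -> : enum_int (4 * d - 3) = (2 * d)%:Z - 1.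
    by rewrite /enum_int; case: ifP; lia.
  move=> [a [b [sa sb ab]]] [c [e [sc se ce]]]; exfalso.
  have /= ha := sd _ sa; have /= hb := sd _ sb.
  have /= hc := sd _ sc; have /= he := sd _ se.
  apply: (not_both_radii s d adm).
  (* With terms of absolute value at most [d], the sum [2d - 1] can only be [d + (d - 1)], and
     [1 - 2d] only its negative. *)
  - have [<-//|<-//] : c = d%:Z \/ e = d%:Z by lia.
  - have [<-//|<-//] : a = - d%:Z \/ b = - d%:Z by lia.
have hP : has (fun n => enum_int n \notin sums s) (iota 0 (4 * d)).
  by apply/hasP; exists j; rewrite ?mem_iota; lia.
have lt4 : (missing_index s d < 4 * d)%N.
  by rewrite /missing_index -[X in (_ < X)%N](size_iota 0) -has_find.
have before i : (i < missing_index s d)%N -> enum_int i \in sums s.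
  move=> im; have := before_find 0%N im.
  by rewrite nth_iota ?add0n; [move/negbFE|lia].
split=> //.
- rewrite (leq_ltn_trans _ jd)// leqNgt; apply/negP => /before.
  by rewrite (negbTE jP).
- have := nth_find 0%N hP.
  by rewrite nth_iota.
Qed.

Lemma missing_bound (s : seq int) (d : nat) : admissible s d ->
  (0 < `|missing s d| <= 2 * d)%N.
Proof.
move=> adm; have [ilt mS _] := missing_indexP s d adm.
have [s0 d0 _ _ _] := adm.
apply/andP; split; last by rewrite enum_int_abs; lia.
rewrite lt0n; apply: contra mS; rewrite absz_eq0 => /eqP ->.
by apply/sumsP; exists 0, 0.
Qed.

(** Old sums lie in [[-2d, 2d]]. Adding an old element to [u] or to [b - u] gives absolute value at
    least [2d], on opposite sides of zero; the doubles [2u] and [2(b - u)] lie farther out, and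
    [u + (b - u) = b] is not an old sum. *)
Lemma step_admissible (s : seq int) (d : nat) : admissible s d ->
  admissible (step (s, d)).1 (step (s, d)).2.
Proof.
move=> adm; have /= bb := missing_bound s d adm.
have [_ bS _] := missing_indexP s d adm.
have nb := not_both_radii s d adm.
have [s0 d0 sd us sid] := adm.
rewrite /step /=; move: (missing s d) bb bS => b bb bS.
have bS' (x y : int) : x \in s -> y \in s -> b = x + y -> False.
  by move=> xs ys bxy; move/sumsP: bS; apply; exists x, y.
have us' (x : int) : (d < `|x|)%N -> x \notin s.
  by move=> dx; apply/negP => /sd; lia.
have opp (x y : int) : x \in s -> y \in s -> y = - x -> `|x|%N = d -> False.
  move=> xs ys yE xd; have [xE|xE] : x = d%:Z \/ x = - d%:Z by lia.
  - by apply: nb; [rewrite -xE|rewrite -xE -yE].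
  - by apply: nb; [have <- : y = d%:Z by lia|rewrite -xE].
have : 0 <= b /\ inner d b = - (3 * d)%:Z \/ b < 0 /\ inner d b = (3 * d)%:Z.
  by rewrite /inner; case: ifP; lia.
move: (inner d b) => u uE.
split.
- by rewrite !inE s0 !orbT.
- lia.
- move=> a; rewrite !inE => /or3P[/eqP->|/eqP->|/sd]; lia.
- have ne : b - u != u by lia.
  have bus : b - u \notin s by apply: us'; lia.
  have us1 : u \notin s by apply: us'; lia.
  by rewrite /= !inE negb_or ne bus us1 us.
- have split_mem (x : int) : x \in [:: b - u, u & s] ->
     [\/ x = b - u, x = u | x \in s /\ (`|x| <= d)%N].
    rewrite !inE => /or3P [/eqP->|/eqP->|xs]; [exact: Or31|exact: Or32|].
    by apply: Or33; split=> //; exact: sd.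
  move=> x y z w.
  move=> /split_mem Hx /split_mem Hy /split_mem Hz /split_mem Hw xy zw e.
  case: Hx => [?|?|[xs xd]]; case: Hy => [?|?|[ys yd]];
  case: Hz => [?|?|[zs zd]]; case: Hw => [?|?|[ws wd]];
  try lia;
  try exact: (sid x y z w).
  (* The size estimates leave two kinds of coincidence: the new sum [b] with an
     old one, and [- 2 d] or [2 d], which would need both [d] and [- d] in [s]. *)
  all: exfalso.
  - by apply: (bS' z w) => //; lia.
  - by apply: (bS' z w) => //; lia.
  - by apply: (opp y z) => //; lia.
  - by apply: (opp x z) => //; lia.
  - by apply: (bS' x y) => //; lia.
  - by apply: (bS' x y) => //; lia.
  - by apply: (opp w x) => //; lia.
  - by apply: (opp z x) => //; lia.
Qed.

(** * Growth and nesting of the stages *)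

Lemma stageS (k : nat) : stage k.+1 = step (elems k, radius k).
Proof. by rewrite /elems /radius -surjective_pairing. Qed.

Lemma stage_admissible (k : nat) : admissible (elems k) (radius k).
Proof.
elim: k => [|k IH]; last by rewrite /elems /radius stageS; exact: step_admissible.
split=> //.
- by move=> a; rewrite !inE => /orP[] /eqP ->.
- move=> a b c e; rewrite !inE.
  by move=> /orP[]/eqP-> /orP[]/eqP-> /orP[]/eqP-> /orP[]/eqP->.
Qed.

Lemma elemsS (k : nat) : exists u v : int,
  [/\ elems k.+1 = [:: v, u & elems k], (`|u| = 3 * radius k)%N &
      (`|v| = radius k.+1)%N].
Proof.
have /= := missing_bound _ _ (stage_admissible k).
exists (inner (radius k) (missing (elems k) (radius k))).
exists (missing (elems k) (radius k) - inner (radius k) (missing (elems k) (radius k))).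
rewrite [elems k.+1]/elems [radius k.+1]/radius stageS /=.
by split=> //; rewrite /inner; case: ifP; lia.
Qed.

Lemma radiusS (k : nat) : (3 * radius k < radius k.+1 <= 5 * radius k)%N.
Proof.
have := missing_bound _ _ (stage_admissible k).
by rewrite [radius k.+1]/radius stageS /=; lia.
Qed.

Lemma radius_bounds (k : nat) : (3 ^ k <= radius k <= 5 ^ k)%N.
Proof. by elim: k => // k IH; have := radiusS k; rewrite !expnS; lia. Qed.

Lemma size_elems (k : nat) : size (elems k) = k.*2.+2.
Proof. by elim: k => // k IH; have [u [v [-> _ _]]] := elemsS k; rewrite /= IH. Qed.

Lemma elems_sub (k m : nat) : (k <= m)%N -> {subset elems k <= elems m}.
Proof.
move=> /subnK <-; elim: (m - k)%N => // l IH a /IH al.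
by rewrite addSn; have [u [v [-> _ _]]] := elemsS (l + k); rewrite !inE al !orbT.
Qed.

Lemma radius_mono (k m : nat) : (k <= m)%N -> (radius k <= radius m)%N.
Proof.
move=> /subnK <-; elim: (m - k)%N => // l IH.
by have := radiusS (l + k); rewrite addSn; lia.
Qed.

(** By induction the first missing index at stage [k] is at least [k]; if it equals [k], the next
    step produces [enum_int k] as the sum of the two new elements. *)
Lemma sums_elems (k n : nat) : (n < k)%N -> enum_int n \in sums (elems k).
Proof.
elim: k n => // k IH n; rewrite ltnS => nk.
have [_ _ before] := missing_indexP _ _ (stage_admissible k).
case: (ltnP n (missing_index (elems k) (radius k))) => [/before|mn].
  move=> /sumsP [a [b [ak bk ->]]]; apply/sumsP.
  by exists a, b; split=> //; exact: (elems_sub _ _ (leqnSn k)).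
case: (ltngtP n k) nk => // [nk _|nk _]; last first.
  have mE : missing_index (elems k) (radius k) = k.
    case: (ltngtP (missing_index (elems k) (radius k)) k) => // [mk|]; last lia.
    have [_ + _] := missing_indexP _ _ (stage_admissible k).
    by rewrite /missing IH.
  apply/sumsP; rewrite /elems stageS /= /missing mE nk.
  set u := inner _ _.
  by exists (enum_int k - u), u; rewrite !inE !eqxx orbT subrK.
have /sumsP [a [b [ak bk ->]]] := IH _ nk; apply/sumsP.
by exists a, b; split=> //; exact: (elems_sub _ _ (leqnSn k)).
Qed.

(** * The union of the stages and unique representation *)

Definition basis : set int := [set a | exists k, a \in elems k].

(** Since the radii increase, every element added after stage [k] has absolute value at least
    [3 * radius k]. *)
Lemma basis_abs (k : nat) (a : int) :
  basis a -> (`|a| < 3 * radius k)%N -> a \in elems k.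
Proof.
move=> [m]; case: (leqP m k) => [mk /(elems_sub _ _ mk)//|/ltnW].
move=> /subnK <-; elim: (m - k)%N => // l IH.
rewrite addSn; have [u [v [-> uE vE]]] := elemsS (l + k).
have := radius_mono _ _ (leq_addl l k); have := radiusS (l + k).
rewrite !inE => r1 r2 /or3P[/eqP aE|/eqP aE|/IH//]; subst; lia.
Qed.

Lemma rep_count_basis (n : int) : rep_count basis n = 1%N.
Proof.
have [j jn] := enum_int_surj n.
have /sumsP [a [b [ak bk nE]]] := sums_elems _ _ (ltnSn j).
rewrite jn in nE.
wlog ab : a b ak bk nE / a <= b => [wl|].
  by case: (leP a b) => [|/ltW] ab; [apply: (wl a b)|apply: (wl b a); rewrite // addrC].
rewrite /rep_count; have -> : representations basis n = [set (a, b)].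
  apply/seteqP; split=> [[c e] /= [[k1 ck] [k2 ek] ce ceE]|_ ->] /=; last first.
    by split=> //; exists j.+1.
  (* A stage containing all four summands, where the Sidon property applies. *)
  pose m := maxn j.+1 (maxn k1 k2).
  have [_ _ _ _ sid] := stage_admissible m.
  have ca : c = a.
    apply: (sid c e a b) => //; last by rewrite ceE.
    - by apply: elems_sub ck; rewrite !leq_max leqnn ?orbT.
    - by apply: elems_sub ek; rewrite !leq_max leqnn ?orbT.
    - by apply: elems_sub ak; rewrite !leq_max leqnn ?orbT.
    - by apply: elems_sub bk; rewrite !leq_max leqnn ?orbT.
  by congr pair => //; apply: (addrI c); rewrite ceE ca.
by rewrite fset_set1 cardfs1.
Qed.

(** * Counting elements and the logarithmic bounds *)

Lemma count_betweenE (R : realType) (A : set int) (s : seq int) (y x : R) :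
  uniq s -> (forall a : int, (A a /\ y <= a%:~R <= x) <-> a \in s) ->
  count_between A y x = size s.
Proof.
move=> us sP; rewrite /count_between.
have -> : elements_between A y x = [set` [fset a in s]%fset].
  by apply/seteqP; split=> a /=; rewrite inE /= => /sP.
by rewrite set_fsetK card_fseq undup_id.
Qed.

Lemma intr_between (R : realType) (a : int) (x : R) :
  (- x <= a%:~R <= x) = ((`|a|%N)%:R <= x).
Proof. by rewrite -ler_norml -intr_norm -natr_absz. Qed.

Lemma radius_bracket (R : realType) (x : R) : 1 <= x ->
  exists k, (radius k)%:R <= x < (radius k.+1)%:R.
Proof.
move=> x1; have ex : exists k, x < (radius k.+1)%:R.
  exists (Num.truncn x); apply: (lt_le_trans (truncnS_gt x)); rewrite ler_nat.
  have /andP[r3 _] := radius_bounds (Num.truncn x).+1.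
  by apply: leq_trans r3; exact/ltnW/ltn_expl.
case: (ex_minnP ex) => k xk kmin; exists k; rewrite xk andbT.
(* Minimality of [k] gives the lower bracket; at [k = 0] it reads [radius 0 = 1 <= x]. *)
case: k xk kmin => [//|k] _ kmin; rewrite leNgt; apply/negP => /kmin.
by rewrite ltnn.
Qed.

(** The boolean summand counts the next element, of absolute value [3 * radius k]; its companion, at
    [radius k.+1], is beyond [x]. *)
Lemma count_basis (R : realType) (k : nat) (x : R) :
  (radius k)%:R <= x < (radius k.+1)%:R ->
  count_between basis (- x) x = (k.*2.+2 + ((3 * radius k)%N%:R <= x)%R)%N.
Proof.
move=> /andP[kx xk].
have [_ _ sd us _] := stage_admissible k.
have [_ _ _ us1 _] := stage_admissible k.+1.
have [u [v [e1 uE vE]]] := elemsS k.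
have ru := radiusS k.
case: (leP (3 * radius k)%N%:R x) => x3 /=.
- rewrite (@count_betweenE _ _ (u :: elems k)) /= ?size_elems ?addn1//.
    by move: us1; rewrite e1 /= => /andP[].
  move=> a; rewrite intr_between inE; split.
  + move=> [Aa ax].
    have ak : (`|a| < radius k.+1)%N by rewrite -(ltr_nat R); apply: le_lt_trans xk.
    have : a \in elems k.+1 by apply: basis_abs => //; lia.
    rewrite e1 !inE => /or3P[/eqP av|->//|->]; last by rewrite orbT.
    by move: ak; rewrite av vE ltnn.
  + move=> /orP[/eqP->|ak]; split.
    * by exists k.+1; rewrite e1 !inE eqxx orbT.
    * by rewrite uE.
    * by exists k.
    * by apply: le_trans kx; rewrite ler_nat; exact: sd.
- rewrite (@count_betweenE _ _ (elems k)) ?size_elems ?addn0//.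
  move=> a; rewrite intr_between; split.
  + by move=> [Aa ax]; apply: basis_abs => //; rewrite -(ltr_nat R);
    apply: le_lt_trans x3.
  + move=> ak; split; first by exists k.
    by apply: le_trans kx; rewrite ler_nat; exact: sd.
Qed.

Theorem theorem2 (R : realType) :
  exists A : set int,
    (forall n : int, rep_count A n = 1%N) /\
    (forall x : R, 1 <= x ->
       2 * ln x / ln 5 + 2 * (1 - ln 3 / ln 5) <= (count_between A (- x) x)%:R
       /\ (count_between A (- x) x)%:R <= 2 * ln x / ln 3 + 2).
Proof.
exists basis; split; first exact: rep_count_basis.
move=> x x1; have [k kx] := radius_bracket R x x1.
rewrite (count_basis R k x kx).
have /andP[kx1 kx2] := kx.
have x0 : 0 < x by apply: lt_le_trans x1.
have l3 : 0 < ln (3 : R) by apply: ln_gt0; lra.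
have l5 : 0 < ln (5 : R) by apply: ln_gt0; lra.
(* This is [5 <= 9]. It closes the lower bound when [3 * radius k <= x]: the count is then [2k + 3],
   while only [x < 5 ^ (k + 1)] is known. *)
have l35 : ln (5 : R) <= 2 * ln 3.
  have -> : 2 * ln (3 : R) = ln (3 ^+ 2) by rewrite lnXn ?mulr_natl//; lra.
  by rewrite ler_ln ?posrE; lra.
have /andP[r3 r5] := radius_bounds k.
have /andP[_ r5S] := radius_bounds k.+1.
have geln3 (m : nat) : (3 ^ m)%:R <= x -> m%:R * ln 3 <= ln x.
  by move=> mx; rewrite mulr_natl -lnXn ?ler_ln ?posrE ?exprn_gt0 -?natrX//; lra.
have leln5 (m : nat) (y : R) : 0 < y -> y <= (5 ^ m)%:R -> ln y <= m%:R * ln 5.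
  by move=> y0 ym; rewrite mulr_natl -lnXn ?ler_ln ?posrE ?exprn_gt0 -?natrX//; lra.
have -> : 2 * ln x / ln 5 + 2 * (1 - ln 3 / ln 5)
    = 2 * (ln x + ln 5 - ln 3) / ln 5 :> R by field; rewrite gt_eqF.
rewrite ler_pdivrMr // -(lerBlDr _ 2) ler_pdivlMr //.
have low : k%:R * ln 3 <= ln x.
  by apply: geln3; apply: le_trans kx1; rewrite ler_nat.
have cE : (k.*2.+2)%:R = 2 * k%:R + 2 :> R.
  by rewrite -addn2 natrD -muln2 natrM mulrC.
case: (leP (3 * radius k)%N%:R x) => x3 /=.
- have dn : (k%:R + 1) * ln 3 <= ln x.
    rewrite natr1; apply: geln3; apply: le_trans x3.
    by rewrite ler_nat expnS leq_mul2l r3.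
  have up : ln x <= (k%:R + 1) * ln 5.
    rewrite natr1; apply: leln5 => //; apply: le_trans (ltW kx2) _.
    by rewrite ler_nat.
  by rewrite natrD cE; split; lra.
(* Here the count is [2k + 2] and [x < 3 * 5 ^ k], which yields exactly the constant
   [2 * (1 - ln 3 / ln 5)]. *)
- have : ln (x / 3) <= k%:R * ln 5.
    apply: leln5; first by rewrite divr_gt0.
    rewrite ler_pdivrMr// -natrM; apply: le_trans (ltW x3) _.
    by rewrite ler_nat mulnC leq_mul2r r5.
  by rewrite ln_div ?posrE// addn0 cE => up; split; lra.
Qed.
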